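(* Let $X\in\mathbb{M}_n$ and let $\varepsilon(X)$ be the inradius of the numerical range $W(X)$. Then, for all $a\in\mathbb{C}$, $$ \varepsilon(X)\ge \|X-aI\|_{\infty}-\left\|\frac{|X-aI|+|X^*-\overline{a}I|}{2}\right\|_{\infty}. $$ Moreover, if $X\in\mathbb{M}_2$ and $a=\tau$ is the normalized trace of $X$, i.e. $\tau=\tfrac12\mathrm{Tr}\,X$, then this inequality is an equality.
   Context: $\mathbb{M}_n$ is the space of $n\times n$ complex matrices; $I$ is the identity matrix; $\|\cdot\|_\infty$ is the operator norm; $|T|=(T^*T)^{1/2}$. $W(X)=\{h^*Xh : h\in\mathbb{C}^n,\ \|h\|=1\}$ is the numerical range of $X$, a compact convex subset of $\mathbb{C}$. The inradius $\varepsilon(X)$ is the radius of the largest possible disc contained in $W(X)$ (so it is $0$ if $W(X)$ is a point or a line segment). *)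

(* Defs.v *)
From HB Require Import structures.
From mathcomp Require Import all_boot all_order all_algebra.
From mathcomp Require Import sesquilinear spectral.
From mathcomp Require Import complex.
From mathcomp Require Import boolp classical_sets reals.

Set Implicit Arguments.
Unset Strict Implicit.
Unset Printing Implicit Defensive.

Import Order.TTheory GRing.Theory Num.Theory.

Local Open Scope classical_set_scope.
Local Open Scope ring_scope.
Local Open Scope sesquilinear_scope.

Section Defs.
Variable R : realType.
Local Notation C := R[i].

Definition vnorm n (h : 'cV[C]_n) : R :=
  Num.sqrt (\sum_i ComplexField.Normc.normc (h i 0) ^+ 2).

Definition opnorm n (X : 'M[C]_n) : R :=
  sup [set vnorm (X *m h) | h in [set h : 'cV[C]_n | vnorm h = 1]].

Definition qform n (X : 'M[C]_n) (h : 'cV[C]_n) : C := (h^t* *m X *m h) 0 0.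

Definition numrange n (X : 'M[C]_n) : set C :=
  [set qform X h | h in [set h : 'cV[C]_n | vnorm h = 1]].

Definition disc (c : C) (r : R) : set C := [set z | `|z - c| <= r%:C%C].

(* Radius 0 is allowed, so that a nonempty range always contains a disc. *)
Definition inradius n (X : 'M[C]_n) : R :=
  sup [set r : R | 0 <= r /\ exists c, disc c r `<=` numrange X].

(* For [z : C], [0 <= z] says that [z] is real and nonnegative; over the complex
   numbers this makes [A] Hermitian. *)
Definition psdmx n (A : 'M[C]_n) : Prop := forall h, 0 <= qform A h.

(* Functional calculus on a spectral decomposition; the value is meaningful
   only when [A] is positive semidefinite. *)
Definition sqrtmx n (A : 'M[C]_n) : 'M[C]_n :=
  let P := spectralmx A in
  invmx P *m diag_mx (map_mx sqrtC (spectral_diag A)) *m P.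

Definition absmx n (T : 'M[C]_n) : 'M[C]_n := sqrtmx (T^t* *m T).

Lemma qform_diag n (P : 'M[C]_n) (d : 'rV[C]_n) (h : 'cV[C]_n) :
  qform (P^t* *m diag_mx d *m P) h = \sum_i d 0 i * `|(P *m h) i 0| ^+ 2.
Proof.
rewrite /qform !mulmxA -map_mxM -trmx_mul -mulmxA mul_mx_diag mxE.
by apply: eq_bigr => i _; rewrite !mxE normCK mulrAC mulrC [X in _ * X]mulrC.
Qed.

Lemma gram_normal n (T : 'M[C]_n) : T^t* *m T \is normalmx.
Proof.
apply/normalmxP; suff -> : (T^t* *m T)^t* = T^t* *m T by [].
by rewrite trmx_mul map_mxM -map_trmx trmxK map_mxCK.
Qed.

Lemma qform_gram_ge0 n (T : 'M[C]_n) (h : 'cV[C]_n) : 0 <= qform (T^t* *m T) h.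
Proof.
have -> : T^t* *m T = T^t* *m diag_mx (const_mx 1) *m T.
  by rewrite diag_const_mx mulmx1.
by rewrite qform_diag; apply: sumr_ge0 => i _; rewrite mxE mul1r exprn_ge0.
Qed.

Lemma gram_spectral_ge0 n (T : 'M[C]_n) i : 0 <= spectral_diag (T^t* *m T) 0 i.
Proof.
set A := T^t* *m T; set P := spectralmx A.
have PU : P \is unitarymx := spectral_unitarymx A.
have := qform_gram_ge0 T (invmx P *m delta_mx i 0); rewrite -/A.
rewrite [X in qform X _](orthomx_spectralP (gram_normal T)) -/A -/P.
rewrite invmx_unitary // qform_diag -invmx_unitary // mulKVmx ?spectral_unit // (bigD1 i) //= big1 => [|j nji].
  by rewrite addr0 mxE !eqxx normr1 expr1n mulr1.
by rewrite mxE (negbTE nji) normr0 expr0n mulr0.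
Qed.

Lemma absmx_psd n (T : 'M[C]_n) : psdmx (absmx T).
Proof.
move=> h; rewrite /absmx /sqrtmx invmx_unitary ?spectral_unitarymx // qform_diag.
apply: sumr_ge0 => i _; rewrite mxE mulr_ge0 ?exprn_ge0 // sqrtC_ge0.
exact: gram_spectral_ge0.
Qed.

Lemma absmx_sqr n (T : 'M[C]_n) : absmx T *m absmx T = T^t* *m T.
Proof.
rewrite [RHS](orthomx_spectralP (gram_normal T)) /absmx /sqrtmx.
set P := spectralmx _; set d := spectral_diag _.
rewrite -!mulmxA (mulmxA P) mulmxV ?spectral_unit // mul1mx; congr (_ *m _).
rewrite mulmxA mulmx_diag; congr (diag_mx _ *m _).
by apply/rowP => i; rewrite !mxE -expr2 sqrtCK.
Qed.

End Defs.

(* Main.v *)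
Require Import Defs.
From mathcomp Require Import all_boot all_order all_algebra.
From mathcomp Require Import sesquilinear spectral complex reals.
From mathcomp Require Import classical_sets ring.

(* Put Y = X - a, s = ||Y||, and let h, k be unit vectors with Y h = s k and
   Y* k = s h, so that |Y| h = s h and |Y*| k = s k.  With kap = <h, k> and
   p = <h, Y k> - s kap^2, testing (|Y| + |Y*|) / 2 on h + u k (u a phase making
   u kap >= 0) and using 2 |<a, Y b>| <= <a, |Y*| a> + <b, |Y| b> gives
     2 (1 + |kap|) (s - ||(|Y| + |Y*|) / 2||) <= s (1 - |kap|^2) - |p|.
   On unit vectors x h + y k the form of Y is s kap + m xi^* + p xi, with
   m = s (1 - |kap|^2) and xi = x^* y, and every |xi| <= 1 / (2 (1 + |kap|))
   occurs, so W(Y) contains the disc of centre s kap whose radius is the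
   claimed one.
   For X of size 2 and a = tr X / 2, let d0, d1 be the eigenvalues of Y*Y.  Then
   YY* + Y*Y is scalar, so |Y| + |Y*| = sqrt d0 + sqrt d1, while some
   Hermitian uY + (uY)*, |u| = 1, squares to (sqrt d0 - sqrt d1)^2, which puts
   W(Y) in a strip of width |sqrt d0 - sqrt d1|. *)

Set Implicit Arguments.
Unset Strict Implicit.
Unset Printing Implicit Defensive.

Import Order.TTheory GRing.Theory Num.Theory.

Local Open Scope ring_scope.
Local Open Scope sesquilinear_scope.

Lemma ord2_cases (i : 'I_2) : i = 0 \/ i = 1.
Proof. by case: i => [[|[|]] //= lt_i]; [left|right]; apply: val_inj. Qed.

(** * Adjoints and the Hermitian inner product *)

Section NumClosed.
Variable C : numClosedFieldType.

Lemma eq_ler (x y : C) : x = y -> x <= y.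
Proof. by move->. Qed.

Lemma adjmxM m n p (A : 'M[C]_(m, n)) (B : 'M_(n, p)) :
  (A *m B)^t* = B^t* *m A^t*.
Proof. by rewrite trmx_mul map_mxM. Qed.

Lemma adjmxD m n (A B : 'M[C]_(m, n)) : (A + B)^t* = A^t* + B^t*.
Proof. by rewrite linearD map_mxD. Qed.

Lemma adjmxB m n (A B : 'M[C]_(m, n)) : (A - B)^t* = A^t* - B^t*.
Proof. by rewrite linearB map_mxB. Qed.

Lemma adjmxZ m n (c : C) (A : 'M[C]_(m, n)) : (c *: A)^t* = c^* *: A^t*.
Proof. by rewrite linearZ map_mxZ. Qed.

Lemma adjmx_scalar n (c : C) : (c%:M : 'M_n)^t* = (c^*)%:M.
Proof. by rewrite tr_scalar_mx map_scalar_mx. Qed.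

Lemma adjmx_diag n (d : 'rV[C]_n) : (diag_mx d)^t* = diag_mx (map_mx Num.Def.conjC d).
Proof. by rewrite tr_diag_mx map_diag_mx. Qed.

Definition dotc n (u v : 'cV[C]_n) : C := (u^t* *m v) 0 0.

Lemma dotcDl n (u v w : 'cV[C]_n) : dotc (u + v) w = dotc u w + dotc v w.
Proof. by rewrite /dotc adjmxD mulmxDl mxE. Qed.

Lemma dotcDr n (u v w : 'cV[C]_n) : dotc u (v + w) = dotc u v + dotc u w.
Proof. by rewrite /dotc mulmxDr mxE. Qed.

Lemma dotcZl n c (u v : 'cV[C]_n) : dotc (c *: u) v = c^* * dotc u v.
Proof. by rewrite /dotc adjmxZ -scalemxAl mxE. Qed.

Lemma dotcZr n c (u v : 'cV[C]_n) : dotc u (c *: v) = c * dotc u v.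
Proof. by rewrite /dotc -scalemxAr mxE. Qed.

Lemma dotcNl n (u v : 'cV[C]_n) : dotc (- u) v = - dotc u v.
Proof. by rewrite -scaleN1r dotcZl rmorphN1 mulN1r. Qed.

Lemma dotcNr n (u v : 'cV[C]_n) : dotc u (- v) = - dotc u v.
Proof. by rewrite -scaleN1r dotcZr mulN1r. Qed.

Lemma dotcC n (u v : 'cV[C]_n) : (dotc u v)^* = dotc v u.
Proof.
rewrite /dotc !mxE rmorph_sum; apply: eq_bigr => i _.
by rewrite !mxE rmorphM /= conjCK mulrC.
Qed.

Lemma dotc_adj m n (A : 'M[C]_(m, n)) u v : dotc u (A *m v) = dotc (A^t* *m u) v.
Proof. by rewrite /dotc adjmxM trmxCK mulmxA. Qed.

Lemma dotcE n (u : 'cV[C]_n) : dotc u u = \sum_i `|u i 0| ^+ 2.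
Proof.
by rewrite /dotc !mxE; apply: eq_bigr => i _; rewrite !mxE normCK mulrC.
Qed.

Lemma dotc_ge0 n (u : 'cV[C]_n) : 0 <= dotc u u.
Proof. by rewrite dotcE sumr_ge0 // => i _; rewrite exprn_ge0. Qed.

Lemma dotc_unitary n (P : 'M[C]_n) u v : P \is unitarymx ->
  dotc (P *m u) (P *m v) = dotc u v.
Proof.
move=> PU; rewrite dotc_adj mulmxA -invmx_unitary // mulVmx ?unitarymx_unit //.
by rewrite mul1mx.
Qed.

(** Diagonal entry j of A^* A is the sum of the squared moduli of column j of A. *)
Lemma mx_eq_gram0 m n (A : 'M[C]_(m, n)) : A^t* *m A = 0 -> A = 0.
Proof.
move=> A0; apply/matrixP => i j.
have := congr1 (fun M : 'M_n => M j j) A0; rewrite !mxE => /eqP.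
under eq_bigr do rewrite !mxE mulrC -normCK.
rewrite psumr_eq0 => [|k _]; last by rewrite exprn_ge0.
by move/allP/(_ i (mem_index_enum _)); rewrite expf_eq0 /= normr_eq0 => /eqP.
Qed.

Lemma form_diag n (P : 'M[C]_n) d w :
  dotc w ((P^t* *m diag_mx d *m P) *m w) = \sum_i d 0 i * `|(P *m w) i 0| ^+ 2.
Proof.
rewrite -2!mulmxA dotc_adj trmxCK mul_diag_mx /dotc mxE.
apply: eq_bigr => i _.
by rewrite [X in X * _]mxE [X in X^*]mxE [X in _ * X]mxE normCKC mulrCA.
Qed.

(** * Functional calculus of normal matrices *)

(** The body is that of [sqrtmx] with [f] in place of [sqrtC], so that [absm] and [absmx] are
    convertible. *)
Definition fmx (f : C -> C) n (A : 'M[C]_n) : 'M[C]_n :=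
  let P := spectralmx A in
  invmx P *m diag_mx (map_mx f (spectral_diag A)) *m P.

Lemma fmxE f n (A : 'M[C]_n) : fmx f A =
  (spectralmx A)^t* *m diag_mx (map_mx f (spectral_diag A)) *m spectralmx A.
Proof. by rewrite /fmx invmx_unitary ?spectral_unitarymx. Qed.

Lemma normal_spectralE n (A : 'M[C]_n) : A \is normalmx ->
  A = (spectralmx A)^t* *m diag_mx (spectral_diag A) *m spectralmx A.
Proof.
by move/orthomx_spectralP => {1}->; rewrite invmx_unitary ?spectral_unitarymx.
Qed.

(* In the two eigenbases an intertwiner has a nonzero (i, j) entry only if the
   i-th and j-th eigenvalues agree. *)
Lemma diag_intertwine f m n (P : 'M[C]_m) (Q : 'M[C]_n) d e (Y : 'M_(m, n)) :
  P \is unitarymx -> Q \is unitarymx ->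
  Y *m (Q^t* *m diag_mx e *m Q) = (P^t* *m diag_mx d *m P) *m Y ->
  Y *m (Q^t* *m diag_mx (map_mx f e) *m Q) =
    (P^t* *m diag_mx (map_mx f d) *m P) *m Y.
Proof.
move=> PU QU YE; pose M := P *m Y *m Q^t*.
have QK (k : nat) (Z : 'M_(k, n)) : Z *m Q^t* *m Q = Z.
  by rewrite -invmx_unitary // mulmxKV ?unitarymx_unit.
have PK (k : nat) (Z : 'M_(m, k)) : P^t* *m (P *m Z) = Z.
  by rewrite -invmx_unitary // mulKmx ?unitarymx_unit.
have PK' (k : nat) (Z : 'M_(m, k)) : P *m (P^t* *m Z) = Z.
  by rewrite -invmx_unitary // mulKVmx ?unitarymx_unit.
have ME : M *m diag_mx e = diag_mx d *m M.
  have := congr1 (fun Z => P *m Z *m Q^t*) YE.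
  by rewrite /M -!mulmxA PK' (unitarymxP QU) mulmx1.
have MfE : M *m diag_mx (map_mx f e) = diag_mx (map_mx f d) *m M.
  move: (M) ME => N NE; apply/matrixP => i j.
  have := congr1 (fun Z : 'M__ => Z i j) NE.
  rewrite !mul_mx_diag !mul_diag_mx !mxE.
  have [->|x0] := eqVneq (N i j) 0; first by rewrite !(mulr0, mul0r).
  by rewrite ![_ * N i j]mulrC => /(mulfI x0) ->.
have := congr1 (fun Z => P^t* *m Z *m Q) MfE.
by rewrite /M -!mulmxA PK (mulmxA Y) (mulmxA _ _ Q) !mulmxA QK.
Qed.

(** Used with B = Y^* Y and A = Y Y^*: it carries Y across functions of its two Gram matrices. *)
Lemma fmx_intertwine f m n (A : 'M[C]_m) (B : 'M[C]_n) (Y : 'M_(m, n)) :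
  A \is normalmx -> B \is normalmx -> Y *m B = A *m Y ->
  Y *m fmx f B = fmx f A *m Y.
Proof.
move=> An Bn YE; rewrite !fmxE; apply: diag_intertwine; rewrite ?spectral_unitarymx //.
by rewrite -!normal_spectralE.
Qed.

(** The identity intertwines the two diagonalisations of A, so f(A) does not depend on the
    eigenbasis. *)
Lemma fmx_diag f n (A Q : 'M[C]_n) e : A \is normalmx -> Q \is unitarymx ->
  A = Q^t* *m diag_mx e *m Q -> fmx f A = Q^t* *m diag_mx (map_mx f e) *m Q.
Proof.
move=> An QU AE; rewrite fmxE -[LHS]mulmx1 -[RHS]mul1mx; apply/esym.
apply: diag_intertwine; rewrite ?spectral_unitarymx //.
by rewrite -normal_spectralE // mulmx1 mul1mx -AE.
Qed.

(** An eigenvector is an n x 1 intertwiner between A and the 1 x 1 matrix l. *)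
Lemma fmx_eigen f n (A : 'M[C]_n) (h : 'cV_n) l : A \is normalmx ->
  A *m h = l *: h -> fmx f A *m h = f l *: h.
Proof.
move=> An hE; rewrite fmxE.
have U1 : (1%:M : 'M[C]_1) \is unitarymx.
  by apply/unitarymxP; rewrite mul1mx adjmx_scalar rmorph1.
have scE x : h *m ((1%:M : 'M[C]_1)^t* *m diag_mx (const_mx x) *m 1%:M) = x *: h.
  by rewrite adjmx_scalar rmorph1 mulmx1 mul1mx diag_const_mx mul_mx_scalar.
rewrite -scE -map_const_mx.
apply/esym; apply: diag_intertwine; rewrite ?spectral_unitarymx //.
by rewrite -normal_spectralE // scE.
Qed.

Lemma fmxM f g n (A : 'M[C]_n) : fmx f A *m fmx g A = fmx (fun x => f x * g x) A.
Proof.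
rewrite /fmx !mulmxA mulmxK ?spectral_unit //; congr (_ *m _).
rewrite -!mulmxA mulmx_diag; congr (_ *m diag_mx _).
by apply/rowP => i; rewrite !mxE.
Qed.

Lemma eq_fmx f g n (A : 'M[C]_n) :
  (forall i, f (spectral_diag A 0 i) = g (spectral_diag A 0 i)) ->
  fmx f A = fmx g A.
Proof.
move=> fg; rewrite /fmx; congr (_ *m diag_mx _ *m _).
by apply/rowP => i; rewrite !mxE.
Qed.

Lemma fmx_id n (A : 'M[C]_n) : A \is normalmx -> fmx id A = A.
Proof.
move=> An; rewrite fmxE [RHS]normal_spectralE //.
by congr (_ *m diag_mx _ *m _); exact: map_mx_id.
Qed.

Lemma fmx0 n (A : 'M[C]_n) : fmx (fun=> 0) A = 0.
Proof.
rewrite /fmx (_ : map_mx _ _ = 0); first by rewrite linear0 mulmx0 mul0mx.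
by apply/rowP => i; rewrite !mxE.
Qed.

Lemma fmxD f g n (A : 'M[C]_n) : fmx f A + fmx g A = fmx (fun x => f x + g x) A.
Proof.
rewrite /fmx -mulmxDl -mulmxDr -linearD; congr (_ *m diag_mx _ *m _).
by apply/rowP => i; rewrite !mxE.
Qed.

Lemma fmx_adj f n (A : 'M[C]_n) : (fmx f A)^t* = fmx (fun x => (f x)^*) A.
Proof.
rewrite !fmxE !adjmxM trmxCK adjmx_diag mulmxA; congr (_ *m diag_mx _ *m _).
by apply/rowP => i; rewrite !mxE.
Qed.

Lemma fmx1 n (A : 'M[C]_n) : fmx (fun=> 1) A = 1%:M.
Proof.
rewrite /fmx (_ : map_mx _ _ = const_mx 1); last by apply/rowP => i; rewrite !mxE.
by rewrite diag_const_mx mulmx1 mulVmx ?spectral_unit.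
Qed.

Lemma adj_mul_normal n (Y : 'M[C]_n) : Y^t* *m Y \is normalmx.
Proof. by apply/normalmxP; rewrite adjmxM trmxCK. Qed.

Lemma mul_adj_normal n (Y : 'M[C]_n) : Y *m Y^t* \is normalmx.
Proof. by rewrite -{1}(trmxCK Y) adj_mul_normal. Qed.

(** With P the spectral basis, the eigenvalue is the squared norm of column i of Y P^*. *)
Lemma gram_eigen_ge0 n (Y : 'M[C]_n) i : 0 <= spectral_diag (Y^t* *m Y) 0 i.
Proof.
set S := Y^t* *m Y; set P := spectralmx S.
have PU : P \is unitarymx := spectral_unitarymx S.
have PK : P *m P^t* = 1%:M by apply/unitarymxP.
have : (Y *m P^t*)^t* *m (Y *m P^t*) = diag_mx (spectral_diag S).
  have SE := normal_spectralE (adj_mul_normal Y).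
  rewrite adjmxM trmxCK -mulmxA (mulmxA _ Y) -/S.
  by rewrite {1}[S]SE -/P -(mulmxA _ P) PK mulmx1 mulmxA PK mul1mx.
move/(congr1 (fun M : 'M__ => M i i)); rewrite [RHS]mxE eqxx mulr1n => <-.
rewrite mxE sumr_ge0 // => j _.
by rewrite [X in _ <= X * _]mxE mxE mulrC -normCK exprn_ge0.
Qed.

(** * The absolute value of a matrix *)

Definition absm n (Y : 'M[C]_n) : 'M[C]_n := fmx sqrtC (Y^t* *m Y).

Lemma absm_adjE n (Y : 'M[C]_n) : absm (Y^t*) = fmx sqrtC (Y *m Y^t*).
Proof. by rewrite /absm trmxCK. Qed.

Lemma absm_adj n (Y : 'M[C]_n) : (absm Y)^t* = absm Y.
Proof.
rewrite fmx_adj; apply: eq_fmx => i; apply: geC0_conj.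
by rewrite sqrtC_ge0 gram_eigen_ge0.
Qed.

Lemma absm_ge0 n (Y : 'M[C]_n) h : 0 <= dotc h (absm Y *m h).
Proof.
rewrite /absm fmxE form_diag sumr_ge0 // => i _.
by rewrite mxE mulr_ge0 ?exprn_ge0 // sqrtC_ge0 gram_eigen_ge0.
Qed.

(* This is positivity of [[|Y*|, Y], [Y*, |Y|]]: the right-hand side minus the
   left-hand side is the form of |Y| at b - |Y|^-1 Y* a, where |Y|^-1 is the
   Moore-Penrose inverse. *)
Lemma Re_form_le_absm n (Y : 'M[C]_n) a b :
  dotc a (Y *m b) + (dotc a (Y *m b))^* <=
    dotc a (absm (Y^t*) *m a) + dotc b (absm Y *m b).
Proof.
pose S := Y^t* *m Y; pose T := Y *m Y^t*.
have Sn : S \is normalmx by apply: adj_mul_normal.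
have Tn : T \is normalmx by apply: mul_adj_normal.
(* Since 0^-1 = 0, [g] vanishes at 0, which makes [G] the Moore-Penrose inverse of |Y|. *)
pose g (x : C) := (sqrtC x)^-1; pose G := fmx g S.
have GH : G^t* = G.
  rewrite fmx_adj; apply: eq_fmx => i; apply: geC0_conj.
  by rewrite invr_ge0 sqrtC_ge0 gram_eigen_ge0.
have gE x : g x * sqrtC x * x = x.
  have [->|x0] := eqVneq x 0; first by rewrite mulr0.
  by rewrite mulVf ?sqrtC_eq0 ?mul1r.
have YGA : Y *m G *m absm Y = Y.
  rewrite -mulmxA /absm fmxM; set P := fmx _ _.
  (* [Q] projects onto the kernel of S, and Y Q = 0 because its Gram matrix is Q S Q = 0. *)
  pose Q := fmx (fun x => 1 - g x * sqrtC x) S.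
  have PQ : P + Q = 1%:M.
    by rewrite fmxD -(fmx1 S); apply: eq_fmx => i /=; rewrite addrC subrK.
  suff YQ : Y *m Q = 0 by rewrite -[RHS]mulmx1 -PQ mulmxDr YQ addr0.
  apply: mx_eq_gram0; rewrite adjmxM -mulmxA (mulmxA _ Y) -/S -{1}(fmx_id Sn).
  rewrite fmx_adj !fmxM -(fmx0 S); apply: eq_fmx => i /=.
  by rewrite [X in _ * X]mulrC mulrBl mul1r gE subrr mulr0.
have AGY : absm Y *m G *m Y^t* = Y^t*.
  by rewrite -[in RHS]YGA adjmxM (adjmxM Y) GH absm_adj mulmxA.
(* Intertwining gives Y G Y^* = g(T) T, and x / sqrt x = sqrt x, also at 0 by the convention on
   inverses. *)
have YGY : Y *m G *m Y^t* = absm (Y^t*).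
  rewrite (fmx_intertwine g Tn Sn) ?mulmxA // -mulmxA -/T -{2}(fmx_id Tn).
  rewrite fmxM absm_adjE; apply: eq_fmx => i /=.
  have [->|x0] := eqVneq (spectral_diag T 0 i) 0; first by rewrite mulr0 sqrtC0.
  by rewrite -{2}[spectral_diag T 0 i]sqrtCK /g expr2 mulKf ?sqrtC_eq0.
pose x := G *m (Y^t* *m a).
have Ax : absm Y *m x = Y^t* *m a by rewrite /x 2!mulmxA AGY.
have bAx : dotc b (absm Y *m x) = (dotc a (Y *m b))^*.
  by rewrite Ax dotc_adj trmxCK dotcC.
have xAb : dotc x (absm Y *m b) = dotc a (Y *m b).
  by rewrite dotc_adj absm_adj Ax [RHS]dotc_adj.
have xAx : dotc x (absm Y *m x) = dotc a (absm (Y^t*) *m a).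
  by rewrite Ax dotc_adj trmxCK /x 2!mulmxA YGY [RHS]dotc_adj absm_adj.
have := absm_ge0 Y (b - x).
rewrite mulmxBr dotcDl !dotcDr !dotcNr !dotcNl bAx xAb xAx => form_ge0.
rewrite -subr_ge0; apply: le_trans form_ge0 _.
by apply: eq_ler; ring.
Qed.

Lemma unit_phase (z : C) : exists2 u : C, u^* * u = 1 & u * z = `|z|.
Proof.
have [->|z0] := eqVneq z 0; first by exists 1; rewrite ?rmorph1 ?mulr1 ?normr0 ?mulr0.
exists (`|z| / z); last by rewrite divfK.
by rewrite -normCKC normf_div normr_id divff ?normr_eq0 ?expr1n.
Qed.

(** Multiplying b by a phase makes <a, Y b> real and nonnegative and leaves <b, |Y| b> unchanged. *)
Lemma form_le_absm n (Y : 'M[C]_n) a b :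
  2 * `|dotc a (Y *m b)| <= dotc a (absm (Y^t*) *m a) + dotc b (absm Y *m b).
Proof.
have [u uu uz] := unit_phase (dotc a (Y *m b)).
have := Re_form_le_absm Y a (u *: b).
rewrite -!scalemxAr !dotcZr dotcZl uz geC0_conj // [u * (_ * _)]mulrCA mulrA uu.
by rewrite mul1r mulr2n mulrDl !mul1r.
Qed.

(** Eliminating xi^* between the equation and its conjugate gives the witness, with determinant m^2
    - |p|^2 = (m + |p|) (m - |p|). Its numerator is at most (m + |p|) |w|, hence the bound. *)
Lemma conj_linear_solve (m p w : C) : `|p| < m ->
  exists2 xi, m * xi^* + p * xi = w & `|xi| * (m - `|p|) <= `|w|.
Proof.
move=> p_lt; have m_gt0 : 0 < m by apply: le_lt_trans p_lt.
have mJ : m^* = m by rewrite geC0_conj ?ltW.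
have d_gt0 : 0 < m - `|p| by rewrite subr_gt0.
have e_gt0 : 0 < m + `|p| by rewrite ltr_wpDr.
have D_gt0 : 0 < (m + `|p|) * (m - `|p|) by rewrite mulr_gt0.
have DE : (m + `|p|) * (m - `|p|) = m ^+ 2 - p * p^* by rewrite -normCK; ring.
exists ((m * w^* - p^* * w) / ((m + `|p|) * (m - `|p|))).
  rewrite fmorph_div rmorphB !rmorphM /= !conjCK mJ (geC0_conj (ltW e_gt0)).
  rewrite (geC0_conj (ltW d_gt0)) DE.
  by field; rewrite -DE gt_eqF.
rewrite normf_div (gtr0_norm D_gt0) invfM mulrA divfK ?gt_eqF //.
rewrite ler_pdivrMr // (le_trans (ler_normB _ _)) // !normrM !norm_conjC.
by rewrite (gtr0_norm m_gt0) -mulrDl mulrC.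
Qed.

(** * The disc obtained from a singular pair *)

Section SingularPair.
Variables (n : nat) (Y : 'M[C]_n) (h k : 'cV[C]_n) (s : C).
Hypotheses (hh : dotc h h = 1) (kk : dotc k k = 1) (s_ge0 : 0 <= s).
Hypotheses (Yh : Y *m h = s *: k) (Yk : Y^t* *m k = s *: h).
Let kap := dotc h k.
Let p := dotc h (Y *m k) - s * kap ^+ 2.

(** Here h is an eigenvector of Y^* Y for s^2, and sqrt (s^2) = s as s >= 0. *)
Lemma absm_sing : absm Y *m h = s *: h.
Proof.
rewrite -[in RHS](sqrCK s_ge0); apply: fmx_eigen; first exact: adj_mul_normal.
by rewrite -mulmxA Yh -scalemxAr Yk scalerA.
Qed.

Lemma absm_adj_sing : absm (Y^t*) *m k = s *: k.
Proof.
rewrite -[in RHS](sqrCK s_ge0) absm_adjE; apply: fmx_eigen.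
  exact: mul_adj_normal.
by rewrite -mulmxA Yk -scalemxAr Yh scalerA.
Qed.

Lemma dotc_Yk : dotc k (Y *m k) = s * kap.
Proof. by rewrite dotc_adj Yk dotcZl geC0_conj. Qed.

Lemma sing_gap N :
  (forall w, dotc w ((absm Y + absm (Y^t*)) *m w) <= 2 * N * dotc w w) ->
  2 * (1 + `|kap|) * (s - N) <= s * (1 - `|kap| ^+ 2) - `|p|.
Proof.
move=> HN; set A := absm Y in HN *; set B := absm (Y^t*) in HN *.
have Ah : A *m h = s *: h := absm_sing.
have Bk : B *m k = s *: k := absm_adj_sing.
have khE : dotc k h = kap^* by rewrite dotcC.
have kE : `|kap| ^+ 2 = kap * kap^* by rewrite normCK.
have sJ : s^* = s by rewrite geC0_conj.
pose t := dotc k (A *m k); pose v := dotc h (B *m h).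
have hAk : dotc h (A *m k) = s * kap.
  by rewrite dotc_adj absm_adj -/A Ah dotcZl sJ.
have kBh : dotc k (B *m h) = s * kap^*.
  by rewrite dotc_adj absm_adj -/B Bk dotcZl sJ khE.
(* The test vectors are the part of h orthogonal to k and the part of k orthogonal to h; for them
   <a, Y b> = p. *)
have Ineq1 : 2 * `|p| <= t + v - 2 * (s * `|kap| ^+ 2).
  have := form_le_absm Y (h - kap^* *: k) (k - kap *: h); rewrite -/A -/B.
  rewrite !mulmxBr -!scalemxAr Yh Ah Bk.
  rewrite !(dotcDl, dotcDr, dotcNl, dotcNr, dotcZl, dotcZr) conjCK.
  rewrite dotc_Yk -/t -/v hAk kBh hh kk khE -/kap.
  rewrite (_ : _ + _ = p); last by rewrite /p; ring.
  by move/le_trans; apply; rewrite kE; apply: eq_ler; ring.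
have [u uu uk] := unit_phase kap.
have ukJ : u^* * kap^* = `|kap| by rewrite -rmorphM uk /= geC0_conj.
have := HN (h + u *: k); rewrite mulmxDl !mulmxDr -!scalemxAr Ah Bk.
rewrite !(dotcDl, dotcDr, dotcNl, dotcNr, dotcZl, dotcZr).
rewrite hAk kBh -/t -/v hh kk khE -/kap => H2.
have Ineq2 : 2 * s + 4 * s * `|kap| + t + v <= 4 * N * (1 + `|kap|).
  suff <- : 2 * N * (1 + u * kap + u^* * kap^* + u^* * u) = 4 * N * (1 + `|kap|).
    suff <- : (1 + u^* * u) * s + 2 * s * (u * kap + u^* * kap^*) + u^* * u * t + v
      = 2 * s + 4 * s * `|kap| + t + v.
      by move: H2; congr (_ <= _); ring.
    by rewrite uu uk ukJ; ring.
  by rewrite uu uk ukJ; ring.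
(* Adding the two inequalities cancels t + v and gives twice the goal. *)
rewrite -(ler_pM2l (ltr0Sn C 1)) -subr_ge0.
have := lerD Ineq1 Ineq2; rewrite -subr_ge0 => /le_trans; apply.
by apply: eq_ler; ring.
Qed.

(* The second equation says that x h + y k is a unit vector. *)
Lemma sing_feasible xi : 2 * `|xi| * (1 + `|kap|) <= 1 ->
  exists x y, x^* * y = xi /\
    x^* * x + y^* * y + xi * kap + xi^* * kap^* = 1.
Proof.
(* Look for x > 0 and y = xi / x. With X = x^2 the norm condition reads X + |xi|^2 / X = M, a
   quadratic in X whose discriminant M^2 - 4 |xi|^2 is nonnegative because 2 |xi| <= M. *)
move=> xi_small; pose M := 1 - xi * kap - (xi * kap)^*.
have MR : M \is Num.real.
  by rewrite CrealE !rmorphB /= conjCK rmorph1 addrAC.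
have MRe : M = 1 - 2 * 'Re (xi * kap).
  by rewrite ReE /M; field.
have M_ge : 2 * `|xi| <= M.
  rewrite MRe lerBrDl -lerBrDr; apply: le_trans (_ : 2 * `|xi * kap| <= _).
    rewrite ler_pM2l ?ltr0n // (le_trans (real_ler_norm (Creal_Re _))) //.
    by rewrite leif_normC_Re_Creal.
  rewrite normrM -subr_ge0; move: xi_small; rewrite -subr_ge0.
  by congr (0 <= _); ring.
have M_gt0 : 0 < M.
  have [xi0|xi0] := eqVneq xi 0; first by rewrite /M xi0 mul0r rmorph0 !subr0 ltr01.
  by apply: lt_le_trans M_ge; rewrite mulr_gt0 ?ltr0n ?normr_gt0.
pose D := sqrtC (M ^+ 2 - 4 * `|xi| ^+ 2).
have D_ge0 : 0 <= D.
  rewrite sqrtC_ge0 subr_ge0 (_ : 4 * _ = (2 * `|xi|) ^+ 2); last by ring.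
  by rewrite lerXn2r ?nnegrE ?mulr_ge0 ?ler0n // ltW.
pose X := (M + D) / 2.
have X_gt0 : 0 < X by rewrite divr_gt0 ?ltr0n // ltr_wpDr.
have XE : X ^+ 2 + `|xi| ^+ 2 = M * X.
  have DE : D ^+ 2 = M ^+ 2 - 4 * `|xi| ^+ 2 by rewrite sqrtCK.
  have -> : `|xi| ^+ 2 = (M ^+ 2 - D ^+ 2) / 4 by rewrite DE; field.
  by rewrite /X; field.
pose x := sqrtC X; have x_gt0 : 0 < x by rewrite sqrtC_gt0.
have xX : x ^+ 2 = X by rewrite sqrtCK.
have x0 : x != 0 by rewrite gt_eqF.
have xJ : x^* = x by rewrite geC0_conj ?ltW.
exists x, (xi / x); split; first by rewrite xJ mulrCA divff ?mulr1.
rewrite -(normCKC (xi / x)) normf_div (gtr0_norm x_gt0) exprMn exprVn xX xJ -expr2 xX.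
suff -> : X + `|xi| ^+ 2 / X = M by rewrite /M rmorphM; ring.
by apply: (mulIf (lt0r_neq0 X_gt0)); rewrite mulrDl divfK ?lt0r_neq0 // -expr2 XE.
Qed.

Lemma sing_disc r w : 0 < r ->
  2 * (1 + `|kap|) * r <= s * (1 - `|kap| ^+ 2) - `|p| -> `|w| <= r ->
  exists2 v, dotc v v = 1 & dotc v (Y *m v) = s * kap + w.
Proof.
move=> r_gt0 r_le w_le; pose m := s * (1 - `|kap| ^+ 2).
have c1_gt0 : 0 < 1 + `|kap| by rewrite ltr_wpDr.
have d_gt0 : 0 < m - `|p| by apply: lt_le_trans r_le; rewrite !mulr_gt0 ?ltr0n.
have m_gt0 : 0 < m by rewrite -(subrK `|p| m) ltr_wpDr.
have p_lt : `|p| < m by rewrite -subr_gt0.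
have [xi xiE xi_le] := conj_linear_solve w p_lt.
(* The chain is 2 |xi| (1 + |kap|) r <= |xi| (m - |p|) <= |w| <= r. *)
have {}xi_le : 2 * `|xi| * (1 + `|kap|) <= 1.
  rewrite -(ler_pM2r r_gt0) mul1r (le_trans _ w_le) // (le_trans _ xi_le) //.
  rewrite (_ : _ * r = `|xi| * (2 * (1 + `|kap|) * r)); last by ring.
  by rewrite ler_wpM2l.
have [x [y [xyE nE]]] := sing_feasible xi_le.
have yxE : y^* * x = xi^* by rewrite -xyE rmorphM /= conjCK mulrC.
exists (x *: h + y *: k).
  rewrite !(dotcDl, dotcDr, dotcZl, dotcZr) hh kk -(dotcC h k) -/kap -[RHS]nE.
  by rewrite -yxE -xyE; ring.
rewrite mulmxDr -!scalemxAr Yh.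
rewrite !(dotcDl, dotcDr, dotcZl, dotcZr) kk dotc_Yk -/kap -xiE.
(* Multiplying s kap by the norm relation [nE] makes both sides quadratic in x, y and their
   conjugates. *)
rewrite -[s * kap in RHS]mulr1 -[X in s * kap * X]nE /m normCK /p -yxE -xyE.
by ring.
Qed.
End SingularPair.

(** In an eigenbasis P of Y^* Y, the squared norm of Y w is the sum of the d j |(P w) j|^2; the
    largest d j bounds it, and h is a matching basis vector. *)
Lemma gram_max_eigen n (Y : 'M[C]_n) : (0 < n)%N ->
  let d := spectral_diag (Y^t* *m Y) 0 in
  exists i0, exists h, [/\ dotc h h = 1, Y^t* *m Y *m h = d i0 *: h,
    forall j, d j <= d i0 & forall w, dotc (Y *m w) (Y *m w) <= d i0 * dotc w w].
Proof.
case: n Y => // n Y _ d; set S := Y^t* *m Y; set P := spectralmx S.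
have PU : P \is unitarymx := spectral_unitarymx S.
have PK : P *m P^t* = 1%:M by apply/unitarymxP.
have SE : S = P^t* *m diag_mx (spectral_diag S) *m P.
  exact: normal_spectralE (adj_mul_normal Y).
have d_ge0 j : 0 <= d j := gram_eigen_ge0 Y j.
(* The order on C is partial; a maximum exists because the eigenvalues are real. *)
have [i0 _ d_le] : extremum_spec >=%R predT d [arg max_(i > ord0) d i]%O.
  by apply: real_arg_maxP => // i _; rewrite ger0_real.
exists i0, (P^t* *m delta_mx i0 0).
have Ph : P *m (P^t* *m delta_mx i0 0) = delta_mx i0 0 :> 'cV_n.+1.
  by rewrite mulmxA PK mul1mx.
split=> [||j|w]; last 2 first.
- exact: d_le.
- have -> : dotc (Y *m w) (Y *m w) = dotc w (S *m w).
    by rewrite -mulmxA [RHS]dotc_adj trmxCK.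
  rewrite {1}SE form_diag -(dotc_unitary _ _ PU) dotcE mulr_sumr.
  by apply: ler_sum => j _; apply: ler_wpM2r; [rewrite exprn_ge0|exact: d_le].
- rewrite -(dotc_unitary _ _ PU) Ph dotcE (bigD1 i0) //= big1 => [|j ji0].
    by rewrite addr0 mxE !eqxx normr1 expr1n.
  by rewrite mxE (negbTE ji0) normr0 expr0n.
rewrite {1}SE -2!mulmxA Ph [RHS]scalemxAr; congr (_ *m _).
apply/colP => j; rewrite mul_diag_mx !mxE.
by case: eqP => [->|_]; rewrite ?mulr0.
Qed.

(** * Traceless matrices of size 2 *)

Lemma matrix2P (A B : 'M[C]_2) : A 0 0 = B 0 0 -> A 0 1 = B 0 1 ->
  A 1 0 = B 1 0 -> A 1 1 = B 1 1 -> A = B.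
Proof.
move=> ? ? ? ?; apply/matrixP => i j.
by case: (ord2_cases i) => ->; case: (ord2_cases j) => ->.
Qed.

Lemma sum2E (F : 'I_2 -> C) : \sum_i F i = F 0 + F 1.
Proof.
by rewrite !big_ord_recl big_ord0 addr0; congr (_ + F _); apply: val_inj.
Qed.

Section Traceless.
Variable Z : 'M[C]_2.
Hypothesis trZ : \tr Z = 0.
Let S := Z^t* *m Z.
Let d i := spectral_diag S 0 i.

Let trZ2 : Z 1 1 = - Z 0 0.
Proof.
apply/eqP; rewrite -subr_eq0 opprK addrC; apply/eqP; rewrite -[RHS]trZ.
by rewrite /mxtrace !big_ord_recl big_ord0 addr0; congr (_ + Z _ _); apply: val_inj.
Qed.

(** Cayley-Hamilton for trace 0, with delta = - det Z. *)
Lemma traceless_sqr : exists delta, Z *m Z = delta%:M.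
Proof.
exists (Z 0 0 ^+ 2 + Z 0 1 * Z 1 0).
by apply: matrix2P; rewrite !mxE sum2E ?trZ2 /=; ring.
Qed.

(** As Z 1 1 = - Z 0 0, the off-diagonal entries cancel and both diagonal ones equal the squared
    Frobenius norm of Z. *)
Lemma traceless_anticomm : exists t, Z *m Z^t* + Z^t* *m Z = t%:M.
Proof.
exists (2 * `|Z 0 0| ^+ 2 + `|Z 0 1| ^+ 2 + `|Z 1 0| ^+ 2).
apply: matrix2P; rewrite mxE [X in X + _]mxE [X in _ + X]mxE !sum2E !mxE.
- by rewrite !normCK /=; ring.
- by rewrite trZ2 rmorphN /=; ring.
- by rewrite trZ2 rmorphN /=; ring.
by rewrite trZ2 rmorphN !normCK /=; ring.
Qed.

Lemma gram_trace : \tr S = d 0 + d 1.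
Proof.
rewrite [S](normal_spectralE (adj_mul_normal Z)) -mulmxA mxtrace_mulC -mulmxA.
rewrite (unitarymxP (spectral_unitarymx _)) mulmx1 -sum2E.
by apply: eq_bigr => i _; rewrite mxE eqxx.
Qed.

Lemma gram_det : \det S = d 0 * d 1.
Proof.
rewrite [S](normal_spectralE (adj_mul_normal Z)) 2!det_mulmx mulrC mulrA.
rewrite -det_mulmx (unitarymxP (spectral_unitarymx _)) det1 mul1r det_diag.
by rewrite !big_ord_recl big_ord0 mulr1; congr (_ * d _); apply: val_inj.
Qed.

(** Taking traces in [traceless_anticomm] identifies the scalar: 2 t = 2 tr S. *)
Lemma gram_adj_sum : Z *m Z^t* + S = (d 0 + d 1)%:M.
Proof.
have [t tE] := traceless_anticomm; rewrite [LHS]tE.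
congr (_%:M); apply: (mulIf (_ : 2 != 0 :> C)); first by rewrite pnatr_eq0.
rewrite -gram_trace mulr_natr -mxtrace_scalar -tE mxtraceD mxtrace_mulC.
by rewrite mulr_natr mulr2n.
Qed.

(** By [gram_adj_sum], Z Z^* is diagonal in the eigenbasis of S with the two eigenvalues exchanged,
    so the square roots add up to a scalar. *)
Lemma absm_sum_traceless :
  absm Z + absm (Z^t*) = (sqrtC (d 0) + sqrtC (d 1))%:M.
Proof.
pose P := spectralmx S; have PU : P \is unitarymx := spectral_unitarymx S.
have PK : P^t* *m P = 1%:M.
  by rewrite -invmx_unitary // mulVmx ?unitarymx_unit.
pose e : 'rV[C]_2 := const_mx (d 0 + d 1) - spectral_diag S.
have ZE : Z *m Z^t* = P^t* *m diag_mx e *m P.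
  rewrite linearB /= mulmxBr mulmxBl -[X in _ - X](normal_spectralE (adj_mul_normal Z)).
  rewrite -[Z^t* *m Z]/S diag_const_mx mul_mx_scalar -scalemxAl PK scalemx1.
  by rewrite -gram_adj_sum addrK.
rewrite absm_adjE (fmx_diag _ (mul_adj_normal Z) PU ZE) /absm fmxE -/P.
rewrite -mulmxDl -mulmxDr -linearD /=.
set D := diag_mx _; suff -> : D = (sqrtC (d 0) + sqrtC (d 1))%:M.
  by rewrite mul_mx_scalar -scalemxAl PK scalemx1.
rewrite -diag_const_mx; congr diag_mx; apply/rowP => i; rewrite !mxE.
case: (ord2_cases i) => ->; rewrite -/(d _); last by rewrite addrK addrC.
by rewrite [d 0 + d 1]addrC addrK.
Qed.

Lemma traceless_strip : exists2 u, `|u| = 1 & forall v, dotc v v = 1 ->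
  `|u * dotc v (Z *m v) + (u * dotc v (Z *m v))^*| <=
    `|sqrtC (d 0) - sqrtC (d 1)|.
Proof.
have [delta dE] := traceless_sqr.
have d_ge0 j : 0 <= d j := gram_eigen_ge0 Z j.
(* The phase satisfies w delta = - |delta|; taking u^2 = w makes the cross terms of H^2 as negative
   as possible. *)
have [w ww wE] := unit_phase (- delta).
have w1 : `|w| = 1.
  by apply/eqP; rewrite -(eqrXn2 (ltn0Sn 1)) ?ler01 // normCKC ww expr1n.
pose u := sqrtC w; have u2 : u ^+ 2 = w by rewrite sqrtCK.
have u1 : `|u| = 1.
  by apply/eqP; rewrite -(eqrXn2 (ltn0Sn 1)) ?ler01 // -normrX u2 w1 expr1n.
have uu : u * u^* = 1 by rewrite -normCK u1 expr1n.
(* From Z^2 = delta: |delta|^2 = |det Z|^2 = det S = d 0 d 1. *)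
have delta_norm : `|delta| = sqrtC (d 0) * sqrtC (d 1).
  apply/eqP; rewrite -(eqrXn2 (ltn0Sn 1)) ?mulr_ge0 ?sqrtC_ge0 //.
  rewrite exprMn !sqrtCK -gram_det det_mulmx.
  have -> : \det (Z^t*) = (\det Z)^* by rewrite det_map_mx det_tr.
  rewrite mulrC -normCK -!normrX [\det Z ^+ 2]expr2 -det_mulmx dE det_scalar.
  by rewrite eqxx.
exists u => // v v1.
(* H^2 = u^2 Z^2 + (u^2 Z^2)^* + (Z Z^* + Z^* Z), three scalar matrices. *)
pose H := u *: Z + u^* *: Z^t*.
have HH : H^t* = H by rewrite adjmxD !adjmxZ conjCK trmxCK addrC.
have deltaE : u ^+ 2 * delta = - `|delta|.
  by rewrite u2 -normrN -wE mulrN opprK.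
have deltaJ : u^* ^+ 2 * delta^* = - `|delta|.
  by rewrite -(geC0_conj (normr_ge0 delta)) -rmorphN -deltaE rmorphM rmorphXn.
have ZZJ : Z^t* *m Z^t* = (delta^*)%:M by rewrite -adjmxM dE adjmx_scalar.
have H2 : H *m H = ((sqrtC (d 0) - sqrtC (d 1)) ^+ 2)%:M.
  rewrite mulmxDl !mulmxDr -!scalemxAl -!scalemxAr !scalerA dE ZZJ.
  rewrite [u^* * u]mulrC uu !scale1r -!expr2 !scale_scalar_mx deltaE deltaJ.
  rewrite addrACA [X in X + _]addrC addrACA -[Z^t* *m Z]/S [S + _]addrC
    gram_adj_sum -!raddfD /=.
  by congr (_%:M); rewrite sqrrB !sqrtCK delta_norm; ring.
have xE : u * dotc v (Z *m v) + (u * dotc v (Z *m v))^* = dotc v (H *m v).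
  rewrite mulmxDl -!scalemxAl dotcDr !dotcZr rmorphM /= [dotc v (Z^t* *m v)]dotc_adj trmxCK.
  by rewrite dotcC.
rewrite xE; set x := dotc v (H *m v).
have xJ : x^* = x by rewrite dotcC [RHS]dotc_adj HH.
rewrite -(ler_pXn2r (ltn0Sn 1)) ?nnegrE ?normr_ge0 //.
have xR : x \is Num.real by rewrite CrealE xJ.
have dR j : sqrtC (d j) \is Num.real by rewrite ger0_real ?sqrtC_ge0.
rewrite !real_normK ?rpredB //.
have HvHv : dotc (H *m v) (H *m v) = (sqrtC (d 0) - sqrtC (d 1)) ^+ 2.
  rewrite dotc_adj HH mulmxA H2 mul_scalar_mx dotcZl v1 mulr1 conj_Creal //.
  by rewrite rpredX ?rpredB.
(* Cauchy-Schwarz for the unit vector v: this says that x^2 is at most the squared norm of H v. *)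
have := dotc_ge0 (H *m v - x *: v).
rewrite !(dotcDl, dotcDr, dotcNl, dotcNr, dotcZl, dotcZr) HvHv v1 -(dotcC v) -/x.
rewrite xJ => H0; rewrite -subr_ge0; apply: le_trans H0 _.
by apply: eq_ler; ring.
Qed.
End Traceless.

(** * Bounds on forms and discs *)

Lemma dotc_eq0 n (u : 'cV[C]_n) : dotc u u = 0 -> u = 0.
Proof.
move=> u0; apply: mx_eq_gram0; apply/matrixP => i j.
by rewrite !ord1 [RHS]mxE.
Qed.

(** Expanding the squared norm of M w - N w gives N times the claim, so N = 0 is treated apart;
    there M w = 0. *)
Lemma Re_form_le n (M : 'M[C]_n) N w : 0 <= N ->
  dotc (M *m w) (M *m w) <= N ^+ 2 * dotc w w ->
  dotc w (M *m w) + (dotc w (M *m w))^* <= 2 * N * dotc w w.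
Proof.
rewrite le0r => /predU1P[->|N_gt0] Mw_le.
  suff -> : M *m w = 0 by rewrite /dotc mulmx0 mxE rmorph0 mulr0 mul0r addr0.
  apply: dotc_eq0; apply/eqP; rewrite eq_le dotc_ge0 andbT.
  by rewrite expr0n mul0r in Mw_le.
rewrite -(ler_pM2l N_gt0) -subr_ge0.
have := dotc_ge0 (M *m w - N *: w).
rewrite !(dotcDl, dotcDr, dotcNl, dotcNr, dotcZl, dotcZr) -(dotcC w).
rewrite (geC0_conj (ltW N_gt0)); rewrite -subr_ge0 in Mw_le.
move=> /addr_ge0/(_ Mw_le)/le_trans; apply.
by apply: eq_ler; ring.
Qed.

(** The points c + r and c - r are the ends of the horizontal diameter of a disc; adding the bounds
    on their real parts cancels c. *)
Lemma diameter_le (c r M N : C) : 0 <= r ->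
  c + r + (c + r)^* <= 2 * M -> - (c - r) + (- (c - r))^* <= 2 * N ->
  2 * r <= M + N.
Proof.
move=> r_ge0 leM leN; rewrite -(ler_pM2l (ltr0Sn C 1)).
rewrite mulrDr; apply: le_trans (lerD leM leN).
rewrite rmorphN rmorphB rmorphD /= (geC0_conj r_ge0).
by apply: eq_ler; ring.
Qed.

(** The points c + r u^* and c - r u^* are the ends of the diameter across the strip, and [rl]
    differs by 4 r between them. *)
Lemma strip_disc_le (c r u q : C) : 0 <= r -> `|u| = 1 ->
  let rl z := u * z + (u * z)^* in
  `|rl (c + r * u^*)| <= q -> `|rl (c - r * u^*)| <= q -> 2 * r <= q.
Proof.
move=> r_ge0 u1 rl le1 le2; rewrite -(ler_pM2l (ltr0Sn C 1)).
have uu : u * u^* = 1 by rewrite -normCK u1 expr1n.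
have rlE : rl (c + r * u^*) - rl (c - r * u^*) = 2 * (2 * r).
  transitivity (2 * (2 * r) * (u * u^*)); last by rewrite uu mulr1.
  rewrite /rl !rmorphM rmorphB rmorphD !rmorphM /= !conjCK (geC0_conj r_ge0).
  by ring.
rewrite -[leLHS]ger0_norm ?mulr_ge0 ?ler0n // -rlE.
by rewrite (le_trans (ler_normB _ _)) // [2 * q]mulr_natl mulr2n lerD.
Qed.

(** For F the square roots of the eigenvalues, the maximum is the norm of Z and the mean is the norm
    of (|Z| + |Z^*|) / 2, so the strip width is twice the gap. *)
Lemma norm_sub_max (F : 'I_2 -> C) i0 : (forall j, F j <= F i0) ->
  `|F 0 - F 1| = 2 * (F i0 - (F 0 + F 1) / 2).
Proof.
move=> F_le; have [i00|i01] := ord2_cases i0.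
- by rewrite i00 in F_le *; rewrite ger0_norm ?subr_ge0 //; field.
by rewrite i01 in F_le *; rewrite distrC ger0_norm ?subr_ge0 //; field.
Qed.

End NumClosed.

(** * Numerical range over R[i] *)

Section NumericalRange.
Variable R : realType.
Local Notation C := R[i].
Local Notation "x %:C" := (real_complex R x).

Lemma qformE n (X : 'M[C]_n) h : qform X h = dotc h (X *m h).
Proof. by rewrite /qform /dotc mulmxA. Qed.

Lemma vnorm_ge0 n (h : 'cV[C]_n) : 0 <= vnorm h.
Proof. exact: sqrtr_ge0. Qed.

Lemma vnorm_sqr n (h : 'cV[C]_n) : (vnorm h)%:C ^+ 2 = dotc h h.
Proof.
rewrite -rmorphXn /= sqr_sqrtr ?sumr_ge0 // => [|i _]; last exact: sqr_ge0.
by rewrite dotcE rmorph_sum; apply: eq_bigr => i _; rewrite rmorphXn.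
Qed.

Lemma vnorm1P n (h : 'cV[C]_n) : vnorm h = 1 <-> dotc h h = 1.
Proof.
split=> [h1|h1]; first by rewrite -vnorm_sqr h1 expr1n.
apply/eqP; rewrite -(eqrXn2 (ltn0Sn 1)) ?ler01 ?vnorm_ge0 // expr1n.
by apply/eqP/complexI; rewrite rmorphXn /= vnorm_sqr.
Qed.

(** The supremum is attained at the top eigenvector given by [gram_max_eigen]. *)
Lemma opnorm_spec n (Y : 'M[C]_n) : (0 < n)%N ->
  let s := opnorm Y in let d := spectral_diag (Y^t* *m Y) 0 in
  exists i0, exists h, [/\ dotc h h = 1, Y^t* *m Y *m h = s%:C ^+ 2 *: h,
    s%:C = sqrtC (d i0), forall j, d j <= d i0 &
    forall w, dotc (Y *m w) (Y *m w) <= s%:C ^+ 2 * dotc w w].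
Proof.
move=> n_gt0 s d; have [i0 [h [h1 hE d_le Yw_le]]] := gram_max_eigen Y n_gt0.
have d_ge0 : 0 <= sqrtC (d i0) by rewrite sqrtC_ge0 gram_eigen_ge0.
have sE : s%:C = sqrtC (d i0); last first.
  by exists i0, h; rewrite sE sqrtCK.
pose s0 := complex.Re (sqrtC (d i0)).
have s0E : s0%:C = sqrtC (d i0) by rewrite RRe_real // ger0_real.
have s0_ge0 : 0 <= s0 by rewrite -ler0c s0E.
rewrite -s0E; congr (_%:C).
have s0_ub : ubound [set vnorm (Y *m w) | w in [set w | vnorm w = 1]]%classic s0.
  move=> _ [w /= /vnorm1P w1 <-]; rewrite -(ler_pXn2r (ltn0Sn 1)) ?nnegrE ?vnorm_ge0 //.
  by rewrite -lecR !rmorphXn /= vnorm_sqr s0E sqrtCK (le_trans (Yw_le w)) // w1 mulr1.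
have s0_in : [set vnorm (Y *m w) | w in [set w | vnorm w = 1]]%classic s0.
  exists h; first exact/vnorm1P.
  apply/eqP; rewrite -(eqrXn2 (ltn0Sn 1)) ?vnorm_ge0 //; apply/eqP/complexI.
  rewrite !rmorphXn /= vnorm_sqr s0E sqrtCK dotc_adj mulmxA hE dotcZl h1 mulr1.
  by rewrite geC0_conj // gram_eigen_ge0.
apply/eqP; rewrite eq_le; apply/andP; split.
  by apply: ge_sup => //; exists s0.
by apply: ub_le_sup => //; exists s0.
Qed.

Lemma opnorm_ge0 n (Y : 'M[C]_n) : (0 < n)%N -> 0 <= opnorm Y.
Proof.
case/(opnorm_spec Y) => i0 [h [_ _ sE _ _]].
by rewrite -ler0c sE sqrtC_ge0 gram_eigen_ge0.
Qed.

Lemma Re_qform_le n (M : 'M[C]_n) w : (0 < n)%N ->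
  dotc w (M *m w) + (dotc w (M *m w))^* <= 2 * (opnorm M)%:C * dotc w w.
Proof.
move=> n_gt0; apply: Re_form_le; first by rewrite ler0c opnorm_ge0.
by have [i0 [h [_ _ _ _ ]]] := opnorm_spec M n_gt0.
Qed.

Lemma numrangeP n (X : 'M[C]_n) z :
  numrange X z <-> exists2 v, dotc v v = 1 & dotc v (X *m v) = z.
Proof.
split=> [[v /vnorm1P v1 <-]|[v v1 <-]]; first by exists v; rewrite ?qformE.
by exists v; [exact/vnorm1P|rewrite qformE].
Qed.

Lemma numrange_shift n (X : 'M[C]_n) a z :
  numrange (X - a%:M) z <-> numrange X (z + a).
Proof.
have E v : dotc v v = 1 -> dotc v ((X - a%:M) *m v) = dotc v (X *m v) - a.
  by move=> v1; rewrite mulmxBl mul_scalar_mx dotcDr dotcNr dotcZr v1 mulr1.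
split=> /numrangeP[v v1 vE]; apply/numrangeP; exists v => //.
  by rewrite -vE E // subrK.
by rewrite E // vE addrK.
Qed.

(** A crude bound: it makes the set of radii bounded above, as [sup] requires in [inradius_ge]. *)
Lemma disc_radius_le n (X : 'M[C]_n) c r : (0 < n)%N -> 0 <= r ->
  (disc c r `<=` numrange X)%classic -> r <= opnorm X + opnorm (- X).
Proof.
move=> n_gt0 r_ge0 sub; have rE : `|r%:C| = r%:C by rewrite ger0_norm // ler0c.
have /numrangeP[v v1 vE] : numrange X (c + r%:C).
  by apply: sub; rewrite /disc /= addrAC subrr add0r rE.
have /numrangeP[w w1 wE] : numrange X (c - r%:C).
  by apply: sub; rewrite /disc /= addrAC subrr add0r normrN rE.
have := Re_qform_le X v n_gt0; rewrite vE v1 mulr1 => leM.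
have := Re_qform_le (- X) w n_gt0; rewrite mulNmx dotcNr wE w1 mulr1 => leN.
have := diameter_le _ leM leN; rewrite ler0c -rmorphD => /(_ r_ge0) le2r.
rewrite -lecR; apply: le_trans le2r.
by rewrite mulr_natl mulr2n lerDl ler0c.
Qed.

Lemma inradius_ge n (X : 'M[C]_n) c r : (0 < n)%N -> 0 <= r ->
  (disc c r `<=` numrange X)%classic -> r <= inradius X.
Proof.
move=> n_gt0 r_ge0 sub; apply: ub_le_sup; last by split=> //; exists c.
exists (opnorm X + opnorm (- X)) => t [t_ge0 [b /disc_radius_le]]; exact.
Qed.

(** Makes the set of radii nonempty, and settles the inequality when its lower bound is at most
    0. *)
Lemma numrange_disc0 n (X : 'M[C]_n) : (0 < n)%N ->
  exists c, (disc c 0 `<=` numrange X)%classic.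
Proof.
move=> /(opnorm_spec X)[_ [h [h1 _ _ _ _]]]; exists (dotc h (X *m h)) => z.
rewrite /disc /= normr_le0 subr_eq0 => /eqP ->.
by apply/numrangeP; exists h.
Qed.

Lemma absmxE n (Y : 'M[C]_n) : absmx Y = absm Y.
Proof. by []. Qed.

Lemma opnorm_le_inradius n (X : 'M[C]_n) a : (0 < n)%N ->
  opnorm (X - a%:M)
    - opnorm (2^-1 *: (absm (X - a%:M) + absm ((X - a%:M)^t*))) <= inradius X.
Proof.
move=> n_gt0; set Y := X - _; set M := 2^-1 *: _; pose r := opnorm Y - opnorm M.
have [r_le0|r_gt0] := leP r 0.
  apply: le_trans r_le0 _; have [c sub] := numrange_disc0 X n_gt0.
  exact: inradius_ge sub.
have [i0 [h [h1 hE _ _ _]]] := opnorm_spec Y n_gt0.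
set s := (opnorm Y)%:C in hE.
(* As the norm of M is nonnegative, r > 0 forces s > 0, and Y h can be divided by s to define k. *)
have s_gt0 : 0 < s.
  rewrite /s -[0]/(0%:C) ltcR; apply: le_lt_trans (opnorm_ge0 M n_gt0) _.
  by rewrite -subr_gt0.
have s0 : s != 0 by rewrite gt_eqF.
have sJ : s^* = s by rewrite geC0_conj ?ltW.
pose k := s^-1 *: (Y *m h).
have Yh : Y *m h = s *: k by rewrite scalerA divff // scale1r.
have Yk : Y^t* *m k = s *: h.
  by rewrite -scalemxAr mulmxA hE scalerA expr2 mulKf.
have k1 : dotc k k = 1.
  apply: (mulfI s0); rewrite -{1}sJ -dotcZl -Yh mulr1.
  by rewrite -[Y]trmxCK -dotc_adj Yk dotcZr h1 mulr1.
have MN w : dotc w ((absm Y + absm (Y^t*)) *m w) <= 2 * (opnorm M)%:C * dotc w w.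
  have := Re_qform_le M w n_gt0; rewrite -scalemxAl dotcZr.
  set x := dotc w _.
  have x_ge0 : 0 <= x by rewrite /x mulmxDl dotcDr addr_ge0 ?absm_ge0.
  rewrite geC0_conj ?mulr_ge0 ?invr_ge0 ?ler0n //.
  by rewrite ![2^-1 * x]mulrC -splitr.
have := sing_gap h1 k1 (ltW s_gt0) Yh Yk MN; rewrite /s -rmorphB -/s -/r => gap.
(* The disc found in W(Y) has centre s kap; W(X) is its translate by a. *)
apply: (@inradius_ge _ _ (s * dotc h k + a) r) => //; first exact: ltW.
move=> z; rewrite /disc /= => z_le.
have [|v v1 vE] := sing_disc h1 k1 (ltW s_gt0) Yh Yk _ gap (w := z - (s * dotc h k + a)) z_le.
  by rewrite -[0]/(0%:C) ltcR.
have -> : z = z - a + a by rewrite subrK.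
by apply/numrange_shift/numrangeP; exists v => //; rewrite vE; ring.
Qed.

Lemma inradius_traceless2 (X : 'M[C]_2) tau : \tr (X - tau%:M) = 0 ->
  inradius X <= opnorm (X - tau%:M)
    - opnorm (2^-1 *: (absm (X - tau%:M) + absm ((X - tau%:M)^t*))).
Proof.
set Z := X - _ => trZ; rewrite (absm_sum_traceless trZ).
set d := fun i => spectral_diag (Z^t* *m Z) 0 i.
set M := 2^-1 *: _.
have [i0 [h [h1 _ sE d_le _]]] := opnorm_spec Z (ltn0Sn 1).
have d_ge0 j : 0 <= sqrtC (d j) by rewrite sqrtC_ge0 gram_eigen_ge0.
pose m := (sqrtC (d 0) + sqrtC (d 1)) / 2.
have m_ge0 : 0 <= m by rewrite divr_ge0 ?addr_ge0 ?ler0n ?d_ge0.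
(* M is the scalar m, so the eigenvalue of M^* M given by [opnorm_spec] is m^2. *)
have NE : (opnorm M)%:C = m.
  have [_ [v [v1 MvE _ _ _]]] := opnorm_spec M (ltn0Sn 1).
  have ME : M = m%:M by rewrite /M scale_scalar_mx mulrC.
  apply/eqP; rewrite -(eqrXn2 (ltn0Sn 1)) ?ler0c ?opnorm_ge0 //; apply/eqP.
  have := congr1 (dotc v) MvE; rewrite dotcZr v1 mulr1 => <-.
  by rewrite -mulmxA dotc_adj trmxCK ME mul_scalar_mx dotcZl dotcZr v1 mulr1 geC0_conj.
have gapE : `|sqrtC (d 0) - sqrtC (d 1)| = 2 * (opnorm Z - opnorm M)%:C.
  rewrite (norm_sub_max (F := fun j => sqrtC (d j)) (i0 := i0)) => [|j].
    by rewrite rmorphB; congr (2 * (_ - _)).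
  by rewrite ler_sqrtC ?d_le // nnegrE gram_eigen_ge0.
apply: ge_sup.
  have [c sub] := numrange_disc0 X (ltn0Sn 1).
  by exists 0; split=> //; exists c.
move=> r [r_ge0 [c sub]]; rewrite -lecR -(ler_pM2l (ltr0Sn C 1)) -gapE.
have [u u1 strip] := traceless_strip trZ.
have rC_ge0 : 0 <= r%:C by rewrite ler0c.
(* Points of the disc, translated by - tau, lie in W(Z) and hence in the strip. *)
have inZ z : `|z - (c - tau)| <= r%:C ->
    `|u * z + (u * z)^*| <= `|sqrtC (d 0) - sqrtC (d 1)|.
  move=> z_le; have /numrange_shift/numrangeP[v v1 <-] : numrange X (z + tau).
    by apply: sub; rewrite /disc /= -[c](subrK tau) opprD addrACA subrr addr0.
  exact: strip.
have uJ1 : `|r%:C * u^*| = r%:C by rewrite normrM norm_conjC u1 mulr1 ger0_norm.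
by apply: (strip_disc_le (c := c - tau) rC_ge0 u1); apply: inZ;
  rewrite addrAC subrr add0r ?normrN uJ1.
Qed.

End NumericalRange.

Theorem corollary3p7 (R : realType) :
  (forall (n : nat) (X : 'M[R[i]]_n) (a : R[i]), (0 < n)%N ->
     inradius X >=
       opnorm (X - a%:M)
       - opnorm (2^-1 *: (absmx (X - a%:M) + absmx (X^t* - (a^*)%:M)))) /\
  (forall X : 'M[R[i]]_2, let tau : R[i] := 2^-1 * \tr X in
     inradius X =
       opnorm (X - tau%:M)
       - opnorm (2^-1 *: (absmx (X - tau%:M) + absmx (X^t* - (tau^*)%:M)))).
Proof.
split=> [n X a n_gt0|X tau]; rewrite !absmxE -adjmx_scalar -adjmxB.
  exact: opnorm_le_inradius.
apply/eqP; rewrite eq_le opnorm_le_inradius // andbT.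
apply: inradius_traceless2; rewrite linearB /= mxtrace_scalar /tau.
have -> : 2^-1 * \tr X *+ 2 = \tr X by rewrite mulr2n -mulrDl -div1r -splitr mul1r.
by rewrite subrr.
Qed.
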